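(* Let $q$ be a complex number with $|q|<1$. Then $$\sum_{n\ge 0} \frac{(-1)^n q^{3\binom{n}{2}+4n}(q;q^3)_n}{(q^9;q^9)_n} = \frac{(q^{4};q^{6})_\infty (q^{12};q^{18})_\infty}{(q^{5};q^{6})_\infty (q^{9};q^{18})_\infty}.$$
   Context: For $n\in\mathbb{N}\cup\{\infty\}$, the $q$-Pochhammer symbol is $(A;q)_n:=\prod_{k=0}^{n-1}(1-Aq^k)$ (with $(A;q)_0=1$). *)

(* Defs.v *)
From Stdlib Require Import Reals.
From Coquelicot Require Import Coquelicot.

Fixpoint binom (n k : nat) : nat :=
  match n, k with
  | _, O => 1
  | O, S _ => 0
  | S n', S k' => binom n' k' + binom n' k
  end.

Fixpoint qpoch (A q : C) (n : nat) : C :=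
  match n with
  | O => 1%C
  | S m => (qpoch A q m * (1 - A * q ^ m))%C
  end.

(* Coquelicot's [lim] is total: this is the limit of the partial products
   whenever they converge, as they do for every [A] when [Cmod q < 1]. *)
Definition qpoch_inf (A q : C) : C :=
  @lim C_CompleteNormedModule (filtermap (qpoch A q) eventually).

(* Main.v *)
(** With [Q = q^3], the series is the case [x = q] of
    [T(x) = sum_n (-1)^n Q^(n(n-1)/2) (x Q)^n (x; Q)_n (Q^2/x; Q^2)_n
                  / ((Q^3; Q^3)_n (x^2 Q; Q^2)_n)],
    since [x^3 = Q] makes [(Q^2/x; Q^2)_n] and [(x^2 Q; Q^2)_n] cancel. A q-WZ
    certificate gives the contiguous relation
    [T(x) = (1 - x Q) (1 - x^3 Q^3) / ((1 - x^2 Q) (1 - x^2 Q^3)) T(x Q^2)].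
    Iterating it and using continuity at [x = 0],
    [T(x) (x^2 Q; Q^2)_oo = (x Q; Q^2)_oo (x^3 Q^3; Q^6)_oo T(0)], and [T(0)] is read
    off from the trivial value [T(1) = 1]. *)

Require Import Defs.
From Stdlib Require Import Reals Lra Lia.
From Coquelicot Require Import Coquelicot.

Local Open Scope C_scope.

(** * Limits of complex sequences *)

Definition is_lim_Cseq (u : nat -> C) (l : C) : Prop :=
  filterlim u eventually (locally (T := C_NormedModule) l).

Lemma is_lim_Cseq_unique (u : nat -> C) (l m : C) :
  is_lim_Cseq u l -> is_lim_Cseq u m -> l = m.
Proof. exact (filterlim_locally_unique (V := C_NormedModule) u l m). Qed.

Lemma is_lim_Cseq_ext (u v : nat -> C) (l : C) :
  (forall n, u n = v n) -> is_lim_Cseq u l -> is_lim_Cseq v l.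
Proof. exact (filterlim_ext u v). Qed.

Lemma is_lim_Cseq_const (c : C) : is_lim_Cseq (fun _ => c) c.
Proof. exact (filterlim_const (U := C_NormedModule) c). Qed.

Lemma is_lim_Cseq_subseq (u : nat -> C) (l : C) (phi : nat -> nat) :
  filterlim phi eventually eventually ->
  is_lim_Cseq u l -> is_lim_Cseq (fun n => u (phi n)) l.
Proof. exact (filterlim_comp _ _ _ phi u _ _ _). Qed.

Lemma is_lim_Cseq_mult (u v : nat -> C) (l m : C) :
  is_lim_Cseq u l -> is_lim_Cseq v m -> is_lim_Cseq (fun n => u n * v n) (l * m).
Proof.
  intros Hu Hv.
  apply (filterlim_comp_2 (H := locally (T := C_NormedModule) m)
           u v (@scal C_AbsRing C_NormedModule)
           (G := locally (T := AbsRing_UniformSpace C_AbsRing) l)).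
  - intros P HP. apply Hu. now apply locally_C.
  - exact Hv.
  - exact (filterlim_scal (V := C_NormedModule) l m).
Qed.

Lemma is_lim_Cseq_Cmod_le (u : nat -> C) (l : C) (b : nat -> R) :
  (forall n, (Cmod (u n - l) <= b n)%R) -> is_lim_seq b 0%R -> is_lim_Cseq u l.
Proof.
  intros Hle Hb.
  apply (filterlim_locally_ball_norm (K := C_AbsRing) (U := C_NormedModule)).
  intros eps. apply is_lim_seq_spec in Hb. destruct (Hb eps) as [N HN].
  exists N. intros n Hn. apply Rle_lt_trans with (b n); [apply Hle|].
  specialize (HN n Hn). apply Rabs_def2 in HN. lra.
Qed.

Lemma lim_filtermap_eventually_eq (u : nat -> C) (l : C) :
  is_lim_Cseq u l -> @lim C_CompleteNormedModule (filtermap u eventually) = l.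
Proof.
  intros Hl. apply (is_lim_Cseq_unique u); [|exact Hl].
  apply (filterlim_locally (U := C_CompleteNormedModule)).
  apply (complete_cauchy (T := C_CompleteNormedModule) (filtermap u eventually)).
  - apply filtermap_proper_filter, eventually_filter.
  - intros eps. exists l.
    exact (proj1 (filterlim_locally (U := C_NormedModule) u l) Hl eps).
Qed.

(** * Complex series *)

Definition CSeries (a : nat -> C) : C :=
  @lim C_CompleteNormedModule (filtermap (sum_n (G := C_NormedModule) a) eventually).

Lemma is_series_CSeries_unique (a : nat -> C) (l : C) :
  is_series (V := C_NormedModule) a l -> CSeries a = l.
Proof. exact (lim_filtermap_eventually_eq (sum_n (G := C_NormedModule) a) l). Qed.

Lemma CSeries_correct (a : nat -> C) :
  ex_series (V := C_NormedModule) a -> is_series (V := C_NormedModule) a (CSeries a).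
Proof. intros [l Hl]. now rewrite (is_series_CSeries_unique a l Hl). Qed.

Lemma is_series_Cminus (a b : nat -> C) (la lb : C) :
  is_series (V := C_NormedModule) a la -> is_series (V := C_NormedModule) b lb ->
  is_series (V := C_NormedModule) (fun n => a n - b n) (la - lb).
Proof. exact (is_series_minus (V := C_NormedModule) a b la lb). Qed.

Lemma Cmod_is_series_le (a : nat -> C) (b : nat -> R) (l : C) :
  (forall n, (Cmod (a n) <= b n)%R) -> ex_series b ->
  is_series (V := C_NormedModule) a l -> (Cmod l <= Series b)%R.
Proof.
  intros Hab Hb Ha.
  apply (filterlim_le (F := eventually) (fun n => Cmod (sum_n (G := C_NormedModule) a n))
           (sum_n b) (Cmod l) (Series b)).
  - exists 0%nat. intros n _.
    eapply Rle_trans; [apply (norm_sum_n_m (V := C_NormedModule) a) | apply sum_n_m_le, Hab].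
  - apply (filterlim_comp _ _ _ _ _ _ _ _ Ha (filterlim_norm (V := C_NormedModule) l)).
  - exact (Series_correct b Hb).
Qed.

(** * Complex numbers in the unit disc *)

Lemma Cmod_mult_le (a b : C) (r s : R) :
  (Cmod a <= r -> Cmod b <= s -> Cmod (a * b) <= r * s)%R.
Proof.
  intros Ha Hb. rewrite Cmod_mult.
  apply Rmult_le_compat; auto using Cmod_ge_0.
Qed.

Lemma Cmod_mult_le_l (a b : C) (r : R) :
  (Cmod a <= r -> Cmod b <= 1 -> Cmod (a * b) <= r)%R.
Proof. intros Ha Hb. rewrite <- (Rmult_1_r r). now apply Cmod_mult_le. Qed.

Lemma Cmod_mult_le_r (a b : C) (r : R) :
  (Cmod a <= 1 -> Cmod b <= r -> Cmod (a * b) <= r)%R.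
Proof. intros Ha Hb. rewrite Cmult_comm. now apply Cmod_mult_le_l. Qed.

Lemma Cmod_mult_lt1_l (a b : C) :
  (Cmod a < 1 -> Cmod b <= 1 -> Cmod (a * b) < 1)%R.
Proof.
  intros Ha Hb. eapply Rle_lt_trans; [|exact Ha].
  apply Cmod_mult_le_l; [apply Rle_refl | exact Hb].
Qed.

Lemma Cmod_mult_lt1_r (a b : C) :
  (Cmod a <= 1 -> Cmod b < 1 -> Cmod (a * b) < 1)%R.
Proof. intros Ha Hb. rewrite Cmult_comm. now apply Cmod_mult_lt1_l. Qed.

Lemma Cmod_pow_le1 (a : C) (n : nat) : (Cmod a <= 1 -> Cmod (a ^ n) <= 1)%R.
Proof.
  intros Ha. rewrite Cmod_pow, <- (pow1 n).
  apply pow_incr. split; [apply Cmod_ge_0 | exact Ha].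
Qed.

Lemma Cmod_pow_S_le (a : C) (n : nat) (r : R) :
  (Cmod a <= 1 -> Cmod a <= r -> Cmod (a ^ S n) <= r)%R.
Proof. intros H1 Hr. apply Cmod_mult_le_l; [exact Hr | now apply Cmod_pow_le1]. Qed.

Lemma Cmod_pow_S_lt1 (a : C) (n : nat) : (Cmod a < 1 -> Cmod (a ^ S n) < 1)%R.
Proof. intros Ha. apply Cmod_mult_lt1_l; [exact Ha | apply Cmod_pow_le1, Rlt_le, Ha]. Qed.

Lemma Cmod_minus_le (a b : C) (r s : R) :
  (Cmod a <= r -> Cmod b <= s -> Cmod (a - b) <= r + s)%R.
Proof.
  intros Ha Hb. rewrite <- Cmod_opp in Hb.
  eapply Rle_trans; [apply Cmod_triangle | now apply Rplus_le_compat].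
Qed.

Lemma Cmod_one_minus_ge (z : C) (r : R) :
  (Cmod z <= r -> 1 - r <= Cmod (1 - z))%R.
Proof.
  intros Hz. assert (H := Cmod_triangle (1 - z) z).
  replace (1 - z + z) with (RtoC 1) in H by ring. rewrite Cmod_1 in H. lra.
Qed.

Lemma one_minus_neq0 (z : C) : (Cmod z < 1)%R -> 1 - z <> 0.
Proof.
  intros Hz. apply Cmod_gt_0.
  assert (H := Cmod_one_minus_ge z _ (Rle_refl _)). lra.
Qed.

#[local] Hint Resolve Cmod_mult_le_l Cmod_mult_le_r Cmod_mult_lt1_l Cmod_mult_lt1_r
  Cmod_pow_le1 Cmod_pow_S_le Cmod_pow_S_lt1 one_minus_neq0 Rlt_le Rle_refl : disc.

Lemma Cmod_0_le1 : (Cmod 0 <= 1)%R.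
Proof. rewrite Cmod_0. lra. Qed.

Lemma Cmod_1_le1 : (Cmod 1 <= 1)%R.
Proof. rewrite Cmod_1. lra. Qed.

Lemma Cmod_minus_le2 (a b : C) : (Cmod a <= 1 -> Cmod b <= 1 -> Cmod (a - b) <= 2)%R.
Proof. exact (Cmod_minus_le a b 1 1). Qed.

#[local] Hint Resolve Cmod_0_le1 Cmod_1_le1 Cmod_minus_le2 : disc.

(* The side conditions that [field] leaves here are all of the form [1 - z <> 0], [|z| < 1]. *)
#[local] Ltac field_disc := field; repeat split; auto 10 with disc.

Lemma Cmod_div_one_minus_le (n u v : C) (m r : R) :
  (r < 1 -> Cmod n <= m -> Cmod u <= r -> Cmod v <= r ->
   Cmod (n / ((1 - u) * (1 - v))) <= m / (1 - r) ^ 2)%R.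
Proof.
  intros Hr Hn Hu Hv.
  assert (Du := Cmod_one_minus_ge u r Hu). assert (Dv := Cmod_one_minus_ge v r Hv).
  assert (Hpos : (0 < (1 - r) ^ 2)%R) by (apply pow_lt; lra).
  rewrite Cmod_div, Cmod_mult by (apply Cmult_neq_0; apply one_minus_neq0; lra).
  apply Rmult_le_compat; [apply Cmod_ge_0 | | exact Hn |].
  - apply Rlt_le, Rinv_0_lt_compat. nra.
  - apply Rinv_le_contravar; [exact Hpos | nra].
Qed.

(** * Products *)

Fixpoint Cprod (f : nat -> C) (n : nat) : C :=
  match n with
  | O => 1
  | S m => Cprod f m * f m
  end.

Lemma Cprod_mult (f g : nat -> C) (n : nat) :
  Cprod (fun k => f k * g k) n = Cprod f n * Cprod g n.
Proof. induction n as [|n IH]; simpl; [|rewrite IH]; ring. Qed.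

Lemma Cprod_eq_1 (f : nat -> C) (n : nat) : (forall k, f k = 1) -> Cprod f n = 1.
Proof. intros Hf. induction n as [|n IH]; simpl; [|rewrite IH, Hf]; ring. Qed.

Lemma Cprod_neq0 (f : nat -> C) (n : nat) : (forall k, f k <> 0) -> Cprod f n <> 0.
Proof.
  intros Hf. induction n as [|n IH]; [apply C1_nz | now apply Cmult_neq_0].
Qed.

Lemma Cmod_Cprod_one_plus_le (a : nat -> C) (n : nat) :
  ex_series (fun k => Cmod (a k)) ->
  (Cmod (Cprod (fun k => 1 + a k)%C n) <= exp (Series (fun k => Cmod (a k))))%R.
Proof.
  intros Ha. set (A := fun k => Cmod (a k)).
  assert (HA : forall k, (0 <= A k)%R) by (intros k; apply Cmod_ge_0).
  assert (Hprod : (Cmod (Cprod (fun k => 1 + a k)%C n) * exp (A n) <= exp (sum_n A n))%R).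
  { induction n as [|n IH].
    - rewrite sum_O. simpl. rewrite Cmod_1. lra.
    - rewrite sum_Sn. change plus with Rplus. rewrite exp_plus. simpl. rewrite Cmod_mult.
      apply Rmult_le_compat_r; [apply Rlt_le, exp_pos|].
      eapply Rle_trans; [|exact IH]. apply Rmult_le_compat_l; [apply Cmod_ge_0|].
      eapply Rle_trans; [apply Cmod_triangle|]. rewrite Cmod_1. apply exp_ineq1_le. }
  assert (Hsum : (sum_n A n <= Series A)%R).
  { apply is_lim_seq_incr_compare; [exact (Series_correct A Ha)|].
    intros k. rewrite sum_Sn. change plus with Rplus. specialize (HA (S k)). lra. }
  assert (Hexp : (exp (sum_n A n) <= exp (Series A))%R)
    by (destruct Hsum as [Hlt | ->]; [apply Rlt_le, exp_increasing, Hlt | apply Rle_refl]).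
  assert (HexpA := exp_ineq1_le (A n)). specialize (HA n).
  assert (Hmod := Cmod_ge_0 (Cprod (fun k => 1 + a k) n)). nra.
Qed.

Lemma ex_lim_Cprod_one_plus (a : nat -> C) :
  ex_series (fun k => Cmod (a k)) ->
  exists l, is_lim_Cseq (Cprod (fun k => 1 + a k)) l.
Proof.
  intros Ha. set (P := Cprod (fun k => 1 + a k)).
  set (d := fun n => match n with O => RtoC 1 | S k => P k * a k end).
  assert (Hd : ex_series (V := C_NormedModule) d).
  { apply ex_series_incr_1.
    apply (ex_series_le (V := C_CompleteNormedModule) (fun k => d (S k))
             (fun k => exp (Series (fun j => Cmod (a j))) * Cmod (a k))%R).
    - intros k. apply Cmod_mult_le; [now apply Cmod_Cprod_one_plus_le | apply Rle_refl].
    - exact (ex_series_scal_l (V := R_NormedModule) _ _ Ha). }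
  destruct Hd as [l Hl]. exists l.
  apply (is_lim_Cseq_ext (sum_n (G := C_NormedModule) d)); [|exact Hl].
  intros n. induction n as [|n IH]; [now rewrite sum_O|].
  rewrite sum_Sn, IH. change (P n + P n * a n = P n * (1 + a n)). ring.
Qed.

(* The product of the inverses [1 / (1 + a k) = 1 - a k / (1 + a k)] converges too, and the
   two limits have product [1]. *)
Lemma is_lim_Cprod_one_plus_neq0 (a : nat -> C) (l : C) (c : R) :
  (0 < c)%R -> (forall k, (c <= Cmod (1 + a k))%R) -> ex_series (fun k => Cmod (a k)) ->
  is_lim_Cseq (Cprod (fun k => 1 + a k)) l -> l <> 0.
Proof.
  intros Hc Hge Ha Hl Hl0.
  assert (Hneq0 : forall k, 1 + a k <> 0).
  { intros k. apply Cmod_gt_0. specialize (Hge k). lra. }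
  set (b := fun k => - a k / (1 + a k)).
  destruct (ex_lim_Cprod_one_plus b) as [m Hm].
  { apply (ex_series_le (V := R_CompleteNormedModule) _ (fun k => Cmod (a k) * / c)%R);
      [|exact (ex_series_scal_r (/ c) _ Ha)].
    intros k. change norm with Rabs. rewrite Rabs_pos_eq by apply Cmod_ge_0.
    unfold b. rewrite Cmod_div, Cmod_opp by apply Hneq0.
    apply Rmult_le_compat_l; [apply Cmod_ge_0 | now apply Rinv_le_contravar]. }
  apply C1_nz. rewrite <- (Cmult_0_l m), <- Hl0.
  apply (is_lim_Cseq_unique (fun _ => 1)); [apply is_lim_Cseq_const|].
  apply (is_lim_Cseq_ext (fun n => Cprod (fun k => 1 + a k) n * Cprod (fun k => 1 + b k) n));
    [|now apply is_lim_Cseq_mult].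
  intros n. rewrite <- Cprod_mult. apply Cprod_eq_1.
  intros k. unfold b. field. apply Hneq0.
Qed.

(** * q-Pochhammer symbols *)

Lemma ex_series_Cmod_opp_geom (a b : C) :
  (Cmod b < 1)%R -> ex_series (fun k => Cmod (- (a * b ^ k))).
Proof.
  intros Hb. apply (ex_series_ext (fun k => Cmod a * Cmod b ^ k)%R).
  - intros k. now rewrite Cmod_opp, Cmod_mult, Cmod_pow.
  - apply (ex_series_scal_l (V := R_NormedModule)), ex_series_geom.
    rewrite Rabs_pos_eq; [exact Hb | apply Cmod_ge_0].
Qed.

Lemma qpoch_Cprod (a b : C) (n : nat) :
  qpoch a b n = Cprod (fun k => 1 + - (a * b ^ k)) n.
Proof. induction n as [|n IH]; simpl; [|rewrite IH]; reflexivity. Qed.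

Lemma is_lim_qpoch (a b : C) :
  (Cmod b < 1)%R -> is_lim_Cseq (qpoch a b) (qpoch_inf a b).
Proof.
  intros Hb. destruct (ex_lim_Cprod_one_plus _ (ex_series_Cmod_opp_geom a b Hb)) as [l Hl].
  apply (is_lim_Cseq_ext _ (qpoch a b)) in Hl; [|intros n; now rewrite qpoch_Cprod].
  unfold qpoch_inf. now rewrite (lim_filtermap_eventually_eq _ l Hl).
Qed.

Lemma qpoch_neq0 (a b : C) (n : nat) :
  (Cmod a < 1)%R -> (Cmod b < 1)%R -> qpoch a b n <> 0.
Proof.
  intros Ha Hb. rewrite qpoch_Cprod. apply Cprod_neq0.
  intros k. apply one_minus_neq0. auto with disc.
Qed.

Lemma qpoch_inf_neq0 (a b : C) :
  (Cmod a < 1)%R -> (Cmod b < 1)%R -> qpoch_inf a b <> 0.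
Proof.
  intros Ha Hb.
  apply (is_lim_Cprod_one_plus_neq0 (fun k => - (a * b ^ k)) _ (1 - Cmod a)); [lra | | |].
  - intros k. apply Cmod_one_minus_ge. auto with disc.
  - now apply ex_series_Cmod_opp_geom.
  - apply (is_lim_Cseq_ext (qpoch a b)); [apply qpoch_Cprod | now apply is_lim_qpoch].
Qed.

(** * Products with geometrically decaying factors *)

Lemma binom_S_2 (n : nat) : binom (S n) 2 = (n + binom n 2)%nat.
Proof.
  assert (binom_1_r : forall m, binom m 1 = m).
  { induction m as [|m IH]; [reflexivity|].
    change (binom (S m) 1) with (binom m 0 + binom m 1)%nat. rewrite IH.
    now destruct m. }
  change (binom (S n) 2) with (binom n 1 + binom n 2)%nat. now rewrite binom_1_r.
Qed.

Definition theta_term (c r : R) (n : nat) : R := (c ^ n * r ^ binom n 2)%R.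

Lemma theta_term_S (c r : R) (n : nat) :
  theta_term c r (S n) = (theta_term c r n * (c * r ^ n))%R.
Proof. unfold theta_term. rewrite binom_S_2, pow_add. simpl. ring. Qed.

Lemma theta_term_le (c d r s : R) (n : nat) :
  (0 <= c <= d -> 0 <= r <= s -> 0 <= theta_term c r n <= theta_term d s n)%R.
Proof.
  intros Hc Hr. unfold theta_term. split.
  - apply Rmult_le_pos; apply pow_le; lra.
  - apply Rmult_le_compat; try (apply pow_le; lra); apply pow_incr; assumption.
Qed.

Lemma theta_term_gt_0 (c r : R) (n : nat) : (0 < c -> 0 < r -> 0 < theta_term c r n)%R.
Proof. intros Hc Hr. apply Rmult_lt_0_compat; now apply pow_lt. Qed.

Lemma ex_series_theta_term (c r : R) :
  (0 <= c)%R -> (0 <= r)%R -> (r < 1)%R -> ex_series (theta_term c r).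
Proof.
  intros Hc Hr Hr1.
  (* The ratio test divides by the terms, so [c] and [r] are first made positive. *)
  set (d := (c + 1)%R). set (s := ((1 + r) / 2)%R).
  assert (Hd : (c <= d /\ 0 < d)%R) by (unfold d; lra).
  assert (Hs : (r <= s /\ 0 < s < 1)%R) by (unfold s; lra).
  assert (Hpos : forall n, (0 < theta_term d s n)%R) by (intros n; now apply theta_term_gt_0).
  apply (ex_series_le (V := R_CompleteNormedModule) _ (fun n => Rabs (theta_term d s n))).
  { intros n. change norm with Rabs.
    destruct (theta_term_le c d r s n) as [Hge Hle]; [lra | lra |].
    rewrite !Rabs_pos_eq; lra. }
  apply ex_series_DAlembert with 0%R; [lra | intros n; apply Rgt_not_eq, Hpos |].
  apply (is_lim_seq_ext (fun n => d * s ^ n)%R).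
  - intros n. specialize (Hpos n). rewrite theta_term_S.
    replace (theta_term d s n * (d * s ^ n) / theta_term d s n)%R with (d * s ^ n)%R
      by (field; lra).
    rewrite Rabs_pos_eq; [reflexivity|]. apply Rmult_le_pos; [|apply pow_le]; lra.
  - replace (Finite 0) with (Rbar_mult (Finite d) (Finite 0)) by (simpl; f_equal; ring).
    apply is_lim_seq_scal_l, is_lim_seq_geom. rewrite Rabs_pos_eq; lra.
Qed.

Lemma Cmod_Cprod_le (f : nat -> C) (c r : R) (n : nat) :
  (forall k, (Cmod (f k) <= c * r ^ k)%R) -> (Cmod (Cprod f n) <= theta_term c r n)%R.
Proof.
  intros Hf. induction n as [|n IH].
  - unfold theta_term. simpl. rewrite Cmod_1. lra.
  - rewrite theta_term_S. now apply Cmod_mult_le.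
Qed.

(* Telescoping gives the factor [n d]; the constant [2 c] absorbs [n <= 2^n]. *)
Lemma Cmod_Cprod_minus_le (f g : nat -> C) (c r d : R) (n : nat) :
  (0 <= c)%R -> (0 <= r)%R -> (0 <= d)%R ->
  (forall k, (Cmod (f k) <= c * r ^ k)%R) ->
  (forall k, (Cmod (g k) <= c * r ^ k)%R) ->
  (forall k, (Cmod (f k - g k) <= d * (c * r ^ k))%R) ->
  (Cmod (Cprod f n - Cprod g n) <= d * theta_term (2 * c) r n)%R.
Proof.
  intros Hc Hr Hd Hf Hg Hfg. induction n as [|n IH].
  - unfold theta_term. simpl. replace (1 - 1) with (RtoC 0) by ring. rewrite Cmod_0. lra.
  - simpl Cprod.
    replace (Cprod f n * f n - Cprod g n * g n)
      with ((Cprod f n - Cprod g n) * g n + Cprod f n * (f n - g n)) by ring.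
    assert (Hfn : (Cmod (Cprod f n) <= theta_term (2 * c) r n)%R).
    { eapply Rle_trans; [now apply Cmod_Cprod_le | apply theta_term_le; lra]. }
    assert (Hleft := Cmod_mult_le _ _ _ _ IH (Hg n)).
    assert (Hright := Cmod_mult_le _ _ _ _ Hfn (Hfg n)).
    eapply Rle_trans; [apply Cmod_triangle|]. rewrite theta_term_S. lra.
Qed.

(** * The cubic series *)

Definition cubic_ratio (Q x y : C) : C :=
  - (Q * y) * (1 - x * y) * (x - (Q * y) ^ 2)
  / ((1 - (Q * y) ^ 3) * (1 - x ^ 2 * Q * y ^ 2)).

(* For [x <> 0] this is
   [(-1)^n Q^(n(n-1)/2) (x Q)^n (x; Q)_n (Q^2/x; Q^2)_n / ((Q^3; Q^3)_n (x^2 Q; Q^2)_n)];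
   the product of successive ratios also makes sense at [x = 0]. *)
Definition cubic_term (Q x : C) : nat -> C := Cprod (fun k => cubic_ratio Q x (Q ^ k)).

Definition cubic_sum (Q x : C) : C := CSeries (cubic_term Q x).

Definition cubic_factor (Q x : C) : C :=
  (1 - x * Q) * (1 - x ^ 3 * Q ^ 3) / ((1 - x ^ 2 * Q) * (1 - x ^ 2 * Q ^ 3)).

Definition cubic_shift (Q x y : C) : C :=
  Q ^ 3 * y ^ 3 * (1 - x * y) * (1 - x * Q * y) * (1 - x * Q ^ 2 * y)
    * (1 - x ^ 2 * Q) * (1 - x ^ 2 * Q ^ 3)
  / ((1 - x * Q) * (1 - x ^ 2 * Q * y ^ 2) * (1 - x ^ 2 * Q ^ 3 * y ^ 2)
      * (1 - x ^ 2 * Q ^ 5 * y ^ 2) * (1 - Q ^ 3 * y ^ 3)).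

Definition cubic_certificate (Q x y : C) : C :=
  x * Q * y * (1 - x * y) * (1 - x * Q ^ 2 * y)
  / ((1 - x ^ 2 * Q * y ^ 2) * (1 - x ^ 2 * Q ^ 3 * y ^ 2)).

Definition cubic_bound (Q : C) : R := (4 / (1 - Cmod Q) ^ 2)%R.

Section CubicSeries.

Variable Q : C.
Hypothesis HQ : (Cmod Q < 1)%R.

Lemma cubic_ratio_shift_1 (x : C) :
  (Cmod x <= 1)%R -> cubic_ratio Q (x * Q ^ 2) 1 = cubic_shift Q x 1.
Proof. intros Hx. unfold cubic_ratio, cubic_shift. field_disc. Qed.

Lemma cubic_shift_mult_ratio (x y : C) :
  (Cmod x <= 1)%R -> (Cmod y <= 1)%R ->
  cubic_shift Q x y * cubic_ratio Q (x * Q ^ 2) (Q * y)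
  = cubic_ratio Q x y * cubic_shift Q x (Q * y).
Proof. intros Hx Hy. unfold cubic_ratio, cubic_shift. field_disc. Qed.

Lemma cubic_certificate_1 (x : C) :
  (Cmod x <= 1)%R -> 1 - cubic_factor Q x = cubic_certificate Q x 1.
Proof. intros Hx. unfold cubic_factor, cubic_certificate. field_disc. Qed.

Lemma cubic_certificate_step (x y : C) :
  (Cmod x <= 1)%R -> (Cmod y <= 1)%R ->
  cubic_certificate Q x y + (cubic_ratio Q x y - cubic_factor Q x * cubic_shift Q x y)
  = cubic_ratio Q x y * cubic_certificate Q x (Q * y).
Proof.
  intros Hx Hy. unfold cubic_ratio, cubic_factor, cubic_shift, cubic_certificate.
  field_disc.
Qed.

Lemma cubic_term_shift (x : C) (n : nat) :
  (Cmod x <= 1)%R ->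
  cubic_term Q (x * Q ^ 2) (S n) = cubic_term Q x n * cubic_shift Q x (Q ^ n).
Proof.
  intros Hx. unfold cubic_term. induction n as [|n IH].
  - simpl Cprod. change (Q ^ 0) with (RtoC 1). rewrite cubic_ratio_shift_1 by exact Hx. ring.
  - simpl Cprod in IH |- *. rewrite IH, Cpow_S, <- !Cmult_assoc.
    rewrite cubic_shift_mult_ratio by auto with disc. reflexivity.
Qed.

Lemma sum_n_cubic_term_telescope (x : C) (n : nat) :
  (Cmod x <= 1)%R ->
  sum_n (G := C_NormedModule)
    (fun k => cubic_term Q x k - cubic_factor Q x * cubic_term Q (x * Q ^ 2) k) n
  = cubic_term Q x n * cubic_certificate Q x (Q ^ n) :> C.
Proof.
  intros Hx. induction n as [|n IH].
  - rewrite sum_O, <- cubic_certificate_1 by exact Hx.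
    unfold cubic_term. simpl Cprod. ring.
  - rewrite sum_Sn, IH, cubic_term_shift by exact Hx. change plus with Cplus.
    change (cubic_term Q x (S n)) with (cubic_term Q x n * cubic_ratio Q x (Q ^ n)).
    rewrite Cpow_S.
    rewrite <- Cmult_assoc, <- cubic_certificate_step by auto with disc. ring.
Qed.

Lemma Cmod_cubic_ratio_le (x y : C) :
  (Cmod x <= 1 -> Cmod y <= 1 -> Cmod (cubic_ratio Q x y) <= cubic_bound Q * Cmod y)%R.
Proof.
  intros Hx Hy. unfold cubic_ratio, cubic_bound.
  replace (4 / (1 - Cmod Q) ^ 2 * Cmod y)%R
    with (Cmod y * 2 * 2 / (1 - Cmod Q) ^ 2)%R by (unfold Rdiv; ring).
  apply Cmod_div_one_minus_le; auto with disc.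
  apply Cmod_mult_le; [apply Cmod_mult_le|]; rewrite ?Cmod_opp; auto with disc.
Qed.

Lemma Cmod_cubic_ratio_minus_le (x y : C) :
  (Cmod x <= 1)%R -> (Cmod y <= 1)%R ->
  (Cmod (cubic_ratio Q x y - cubic_ratio Q 0 y) <= Cmod x * (cubic_bound Q * Cmod y))%R.
Proof.
  intros Hx Hy.
  replace (cubic_ratio Q x y - cubic_ratio Q 0 y)
    with (x * (- (Q * y) * (1 - x * y + (Q * y) ^ 2 * y * (1 - x * Q * y))
               / ((1 - (Q * y) ^ 3) * (1 - x ^ 2 * Q * y ^ 2))))
    by (unfold cubic_ratio; field_disc).
  apply Cmod_mult_le; [apply Rle_refl|]. unfold cubic_bound.
  replace (4 / (1 - Cmod Q) ^ 2 * Cmod y)%R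
    with (Cmod y * (2 + 1 * 2) / (1 - Cmod Q) ^ 2)%R by (unfold Rdiv; ring).
  apply Cmod_div_one_minus_le; auto with disc.
  apply Cmod_mult_le; [rewrite Cmod_opp; auto with disc|].
  eapply Rle_trans; [apply Cmod_triangle|].
  apply Rplus_le_compat; [|apply Cmod_mult_le]; auto with disc.
Qed.

Lemma Cmod_cubic_certificate_le (x y : C) :
  (Cmod x <= 1 -> Cmod y <= 1 -> Cmod (cubic_certificate Q x y) <= cubic_bound Q)%R.
Proof.
  intros Hx Hy. unfold cubic_certificate, cubic_bound.
  replace 4%R with (1 * 2 * 2)%R by ring.
  apply Cmod_div_one_minus_le; auto with disc.
  apply Cmod_mult_le; [apply Cmod_mult_le|]; auto 10 with disc.
Qed.

Lemma cubic_bound_ge_0 : (0 <= cubic_bound Q)%R.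
Proof.
  unfold cubic_bound. apply Rmult_le_pos; [lra|]. apply Rlt_le, Rinv_0_lt_compat, pow_lt. lra.
Qed.

Lemma Cmod_cubic_ratio_pow_le (x : C) (n : nat) :
  (Cmod x <= 1 -> Cmod (cubic_ratio Q x (Q ^ n)) <= cubic_bound Q * Cmod Q ^ n)%R.
Proof. intros Hx. rewrite <- Cmod_pow. apply Cmod_cubic_ratio_le; auto with disc. Qed.

Lemma Cmod_cubic_term_le (x : C) (n : nat) :
  (Cmod x <= 1 -> Cmod (cubic_term Q x n) <= theta_term (cubic_bound Q) (Cmod Q) n)%R.
Proof. intros Hx. apply Cmod_Cprod_le. intros k. now apply Cmod_cubic_ratio_pow_le. Qed.

Lemma Cmod_cubic_term_minus_le (x : C) (n : nat) :
  (Cmod x <= 1)%R ->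
  (Cmod (cubic_term Q x n - cubic_term Q 0 n)
   <= Cmod x * theta_term (2 * cubic_bound Q) (Cmod Q) n)%R.
Proof.
  intros Hx. apply Cmod_Cprod_minus_le; try apply Cmod_ge_0; [apply cubic_bound_ge_0 | | |];
    intros k; [apply Cmod_cubic_ratio_pow_le; auto with disc.. |].
  rewrite <- Cmod_pow. apply Cmod_cubic_ratio_minus_le; auto with disc.
Qed.

Lemma is_series_cubic_sum (x : C) :
  (Cmod x <= 1)%R -> is_series (V := C_NormedModule) (cubic_term Q x) (cubic_sum Q x).
Proof.
  intros Hx. apply CSeries_correct.
  apply (ex_series_le (V := C_CompleteNormedModule) _ (theta_term (cubic_bound Q) (Cmod Q))).
  - intros n. now apply Cmod_cubic_term_le.
  - apply ex_series_theta_term; [apply cubic_bound_ge_0 | apply Cmod_ge_0 | exact HQ].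
Qed.

Lemma cubic_sum_contiguous (x : C) :
  (Cmod x <= 1)%R -> cubic_sum Q x = cubic_factor Q x * cubic_sum Q (x * Q ^ 2).
Proof.
  intros Hx. apply Ceq_minus.
  apply (is_lim_Cseq_unique (fun n => cubic_term Q x n * cubic_certificate Q x (Q ^ n))).
  - apply (is_lim_Cseq_ext _ _ _ (fun n => sum_n_cubic_term_telescope x n Hx)).
    apply is_series_Cminus; [now apply is_series_cubic_sum|].
    apply (is_series_scal_l (V := C_NormedModule) (cubic_factor Q x)), is_series_cubic_sum.
    auto with disc.
  - apply (is_lim_Cseq_Cmod_le _ _
             (fun n => theta_term (cubic_bound Q) (Cmod Q) n * cubic_bound Q)%R).
    + intros n. unfold Cminus. rewrite Copp_0, Cplus_0_r.
      apply Cmod_mult_le; [now apply Cmod_cubic_term_le|].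
      apply Cmod_cubic_certificate_le; auto with disc.
    + apply ex_series_lim_0, ex_series_scal_r, ex_series_theta_term;
        [apply cubic_bound_ge_0 | apply Cmod_ge_0 | exact HQ].
Qed.

Lemma Cmod_cubic_sum_minus_le (x : C) :
  (Cmod x <= 1)%R ->
  (Cmod (cubic_sum Q x - cubic_sum Q 0)
   <= Cmod x * Series (theta_term (2 * cubic_bound Q) (Cmod Q)))%R.
Proof.
  intros Hx. rewrite <- Series_scal_l.
  apply (Cmod_is_series_le (fun n => cubic_term Q x n - cubic_term Q 0 n)).
  - intros n. now apply Cmod_cubic_term_minus_le.
  - apply (ex_series_scal_l (V := R_NormedModule)), ex_series_theta_term;
      [|apply Cmod_ge_0 | exact HQ].
    apply Rmult_le_pos; [lra | apply cubic_bound_ge_0].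
  - apply is_series_Cminus; apply is_series_cubic_sum; auto with disc.
Qed.

Lemma is_lim_cubic_sum_0 (u : nat -> C) :
  (forall n, (Cmod (u n) <= 1)%R) -> is_lim_seq (fun n => Cmod (u n)) 0%R ->
  is_lim_Cseq (fun n => cubic_sum Q (u n)) (cubic_sum Q 0).
Proof.
  intros Hu Hlim.
  apply (is_lim_Cseq_Cmod_le _ _ _ (fun n => Cmod_cubic_sum_minus_le (u n) (Hu n))).
  replace (Finite 0) with (Rbar_mult (Finite 0)
    (Series (theta_term (2 * cubic_bound Q) (Cmod Q)))) by (simpl; f_equal; ring).
  now apply is_lim_seq_scal_r.
Qed.

Lemma cubic_sum_iterate (x : C) (k : nat) :
  (Cmod x <= 1)%R ->
  cubic_sum Q x * qpoch (x ^ 2 * Q) (Q ^ 2) (2 * k) =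
  qpoch (x * Q) (Q ^ 2) k * qpoch (x ^ 3 * Q ^ 3) (Q ^ 6) k
    * cubic_sum Q (x * (Q ^ 2) ^ k).
Proof.
  intros Hx. induction k as [|k IH].
  - replace (x * (Q ^ 2) ^ 0) with x by ring. simpl qpoch. ring.
  - replace (2 * S k)%nat with (S (S (2 * k))) by lia.
    cbn [qpoch]. rewrite <- Cmult_assoc, Cmult_assoc, IH.
    rewrite (cubic_sum_contiguous (x * (Q ^ 2) ^ k)) by auto with disc.
    replace (x * (Q ^ 2) ^ k * Q ^ 2) with (x * (Q ^ 2) ^ S k) by (rewrite Cpow_S; ring).
    replace (Q ^ 6) with ((Q ^ 2) ^ 3) by ring.
    rewrite (Cpow_S (Q ^ 2) (2 * k)), (Nat.mul_comm 2 k), (Cpow_mult_r (Q ^ 2) k 2),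
      <- (Cpow_mult_r (Q ^ 2) 3 k), (Nat.mul_comm 3 k), (Cpow_mult_r (Q ^ 2) k 3).
    assert (Hy : (Cmod ((Q ^ 2) ^ k) <= 1)%R) by auto with disc.
    set (y := (Q ^ 2) ^ k) in *. clearbody y. unfold cubic_factor. field_disc.
Qed.

Lemma cubic_sum_mult_qpoch_inf (x : C) :
  (Cmod x <= 1)%R ->
  cubic_sum Q x * qpoch_inf (x ^ 2 * Q) (Q ^ 2) =
  qpoch_inf (x * Q) (Q ^ 2) * qpoch_inf (x ^ 3 * Q ^ 3) (Q ^ 6) * cubic_sum Q 0.
Proof.
  intros Hx.
  apply (is_lim_Cseq_unique (fun k => cubic_sum Q x * qpoch (x ^ 2 * Q) (Q ^ 2) (2 * k))).
  - apply is_lim_Cseq_mult; [apply is_lim_Cseq_const|].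
    apply (is_lim_Cseq_subseq (qpoch (x ^ 2 * Q) (Q ^ 2))).
    + apply eventually_subseq. lia.
    + apply is_lim_qpoch. auto with disc.
  - apply (is_lim_Cseq_ext _ _ _ (fun k => eq_sym (cubic_sum_iterate x k Hx))).
    apply is_lim_Cseq_mult; [apply is_lim_Cseq_mult; apply is_lim_qpoch; auto with disc|].
    apply is_lim_cubic_sum_0; [auto with disc|].
    apply (is_lim_seq_ext (fun k => Cmod x * Cmod (Q ^ 2) ^ k)%R).
    { intros k. now rewrite Cmod_mult, (Cmod_pow (Q ^ 2)). }
    replace (Finite 0) with (Rbar_mult (Cmod x) 0) by (simpl; f_equal; ring).
    apply is_lim_seq_scal_l, is_lim_seq_geom.
    rewrite Rabs_pos_eq by apply Cmod_ge_0. auto with disc.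
Qed.

Lemma cubic_sum_1 : cubic_sum Q 1 = 1.
Proof.
  assert (Hterm : forall n, cubic_term Q 1 (S n) = 0).
  { induction n as [|n IH].
    - unfold cubic_term. simpl Cprod. unfold cubic_ratio, Cdiv. simpl. ring.
    - change (cubic_term Q 1 (S n) * cubic_ratio Q 1 (Q ^ S n) = 0). rewrite IH. ring. }
  apply is_series_CSeries_unique.
  apply (is_lim_Cseq_ext (fun _ => 1)); [|apply is_lim_Cseq_const].
  intros n. induction n as [|n IH]; [now rewrite sum_O|].
  rewrite sum_Sn, <- IH, Hterm. change (RtoC 1 = 1 + 0). ring.
Qed.

Lemma qpoch_inf_mult_cubic_sum_0 : qpoch_inf (Q ^ 3) (Q ^ 6) * cubic_sum Q 0 = 1.
Proof.
  assert (Hsum1 := cubic_sum_mult_qpoch_inf 1 Cmod_1_le1).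
  rewrite cubic_sum_1, !Cpow_1_l, !Cmult_1_l, <- Cmult_assoc in Hsum1.
  assert (Hneq0 : qpoch_inf Q (Q ^ 2) <> 0) by (apply qpoch_inf_neq0; auto with disc).
  rewrite <- (Cmult_1_l (_ * _)), <- (Cinv_l _ Hneq0), <- Cmult_assoc, <- Hsum1. reflexivity.
Qed.

Lemma cubic_sum_eq (x : C) :
  (Cmod x <= 1)%R ->
  cubic_sum Q x =
  qpoch_inf (x * Q) (Q ^ 2) * qpoch_inf (x ^ 3 * Q ^ 3) (Q ^ 6)
    / (qpoch_inf (x ^ 2 * Q) (Q ^ 2) * qpoch_inf (Q ^ 3) (Q ^ 6)).
Proof.
  intros Hx.
  rewrite <- (Cmult_1_r (_ * qpoch_inf (x ^ 3 * _) _)), <- qpoch_inf_mult_cubic_sum_0.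
  rewrite (Cmult_comm (qpoch_inf (Q ^ 3) _) (cubic_sum Q 0)), Cmult_assoc.
  rewrite <- cubic_sum_mult_qpoch_inf by exact Hx.
  field. split; apply qpoch_inf_neq0; auto with disc.
Qed.

End CubicSeries.

Lemma cubic_ratio_cube (q y : C) :
  (Cmod q < 1)%R -> (Cmod y <= 1)%R ->
  cubic_ratio (q ^ 3) q y = - q ^ 4 * y * (1 - q * y) / (1 - q ^ 9 * y ^ 3).
Proof.
  intros Hq Hy. unfold cubic_ratio.
  (* Both [q - (q^3 y)^2] and [1 - q^2 q^3 y^2] contain the factor [1 - q^5 y^2]. *)
  field_disc.
Qed.

Lemma cubic_term_cube (q : C) (n : nat) :
  (Cmod q < 1)%R ->
  cubic_term (q ^ 3) q n =
  (-1) ^ n * q ^ (3 * binom n 2 + 4 * n) * qpoch q (q ^ 3) n / qpoch (q ^ 9) (q ^ 9) n.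
Proof.
  intros Hq. induction n as [|n IH].
  - unfold cubic_term. simpl. field.
  - change (cubic_term (q ^ 3) q (S n))
      with (cubic_term (q ^ 3) q n * cubic_ratio (q ^ 3) q ((q ^ 3) ^ n)).
    rewrite IH, cubic_ratio_cube by auto with disc. cbn [qpoch].
    replace (3 * binom (S n) 2 + 4 * S n)%nat
      with (3 * binom n 2 + 4 * n + (4 + 3 * n))%nat by (rewrite binom_S_2; lia).
    replace ((q ^ 9) ^ n) with (((q ^ 3) ^ n) ^ 3)
      by (rewrite <- !Cpow_mult_r; f_equal; lia).
    rewrite !Cpow_add_r, (Cpow_S (-1) n), (Cpow_mult_r q 3 n).
    field. split; [auto 10 with disc | apply qpoch_neq0; auto with disc].
Qed.

Theorem theorem1p2 (q : C) (hq : (Cmod q < 1)%R) :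
  is_series
    (fun n : nat =>
       ((-1) ^ n * q ^ (3 * binom n 2 + 4 * n) * qpoch q (q ^ 3) n
          / qpoch (q ^ 9) (q ^ 9) n)%C)
    ((qpoch_inf (q ^ 4) (q ^ 6) * qpoch_inf (q ^ 12) (q ^ 18))
       / (qpoch_inf (q ^ 5) (q ^ 6) * qpoch_inf (q ^ 9) (q ^ 18)))%C.
Proof.
  assert (Hq3 : (Cmod (q ^ 3) < 1)%R) by auto with disc.
  apply (is_series_ext (V := C_NormedModule) (cubic_term (q ^ 3) q)).
  { intros n. now apply cubic_term_cube. }
  replace (q ^ 4) with (q * q ^ 3) by ring.
  replace (q ^ 5) with (q ^ 2 * q ^ 3) by ring.
  replace (q ^ 12) with (q ^ 3 * (q ^ 3) ^ 3) by ring.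
  replace (q ^ 9) with ((q ^ 3) ^ 3) by ring.
  replace (q ^ 6) with ((q ^ 3) ^ 2) by ring.
  replace (q ^ 18) with ((q ^ 3) ^ 6) by ring.
  rewrite <- (cubic_sum_eq (q ^ 3) Hq3 q) by auto with disc.
  apply is_series_cubic_sum; auto with disc.
Qed.
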